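(* Let $A\in k_n[[z]]$ with $n\ge2$, and $F\in k_{nm}[[z]]$ with $m\ge1$. Then the equation $F=X\circ A$ has a solution $X\in k_m[[z]]$ if and only if $G_A\subseteq G_F$. In particular, for $A,B\in\Gamma$ of the same order, the equality $G_A=G_B$ holds if and only if $B=\mu\circ A$ for some $\mu\in k_1[[z]]$.
   Context: $k$ is an algebraically closed field of characteristic zero and $k[[z]]$ is the ring of formal power series over $k$. The order of a nonzero $A=\sum_{n\ge0}c_nz^n$ is $\operatorname{ord}A=\min\{n : c_n\ne0\}$. $k_n[[z]]$ is the set of series of order exactly $n$; $k_1[[z]]$ is a group under composition $\circ$. $\Gamma$ is the set of (nonzero) series of order at least $2$. For $A\in\Gamma$, the transition group is $G_A=\{\phi\in k_1[[z]] : A\circ\phi=A\}$, a group under composition. *)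

(* Defs.v *)
From mathcomp Require Export all_boot all_algebra.
From mathcomp Require Export classical_sets.

Set Implicit Arguments.
Unset Strict Implicit.
Unset Printing Implicit Defensive.

Import GRing.Theory.
Local Open Scope ring_scope.
Local Open Scope classical_set_scope.

(* The series \sum_n c_n z^n is represented by n |-> c_n. *)
Definition fps (k : closedFieldType) := nat -> k.

Section FPS.

Variable k : closedFieldType.
Implicit Types A B X F phi : fps k.

Definition fps_one : fps k := fun n => (n == 0%N)%:R.

Definition fps_mul A B : fps k :=
  fun n => \sum_(i < n.+1) A i * B (n - i)%N.

Definition fps_exp A m : fps k := iter m (fps_mul A) fps_one.

(* If A has zero constant term then A^i has no term of degree < i
   (fps_exp_lt), so the coefficient of z^n in \sum_i X_i A^i is the finite
   sum below. The definition is meaningful only for such A. *)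
Definition fps_comp X A : fps k :=
  fun n => \sum_(i < n.+1) X i * fps_exp A i n.

Definition fps_ord A n := A n != 0 /\ forall i, (i < n)%N -> A i = 0.

(* k_n[[z]] *)
Definition fps_of_ord n : set (fps k) := [set A | fps_ord A n].

(* \Gamma; having an order entails being nonzero. *)
Definition Gamma : set (fps k) :=
  [set A | exists2 n, (2 <= n)%N & fps_ord A n].

Definition transition_group A : set (fps k) :=
  [set phi | fps_of_ord 1 phi /\ fps_comp A phi = A].

Lemma fps_exp_lt A m n : A 0%N = 0 -> (n < m)%N -> fps_exp A m n = 0.
Proof.
move=> A0; elim: m n => [|m IHm] n //= lt_nm.
rewrite /fps_mul big1 // => -[[|i] lt_in] _ /=; first by rewrite A0 mul0r.
rewrite -/(fps_exp A m) IHm ?mulr0 //.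
apply: (@leq_trans n); last by rewrite -ltnS.
by rewrite ltn_subrL (leq_ltn_trans (leq0n i) lt_in).
Qed.

End FPS.

(* Main.v *)
(* In characteristic zero A = a^n = z^n o a for some a of order 1, and with e a
   primitive n-th root of unity G_A contains a^-1 o (e z) o a.  If G_F contains
   it as well, then Y = F o a^-1 satisfies Y(e z) = Y(z), so that Y = X(z^n) for
   some X, and F = X o z^n o a = X o A. *)

Require Import Defs.
From mathcomp Require Import all_boot all_algebra.
From mathcomp Require Import classical_sets.
From mathcomp Require Import boolp.
From mathcomp Require Import all_solvable all_field zify.

Set Implicit Arguments.
Unset Strict Implicit.
Unset Printing Implicit Defensive.

Import GRing.Theory.
Local Open Scope ring_scope.
Local Open Scope classical_set_scope.

(** * Course-of-values recursion and roots of unity *)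

(** Serves to build a series coefficient by coefficient: [f] receives all earlier coefficients, and
    the length of that list is the current index. *)
Lemma course_of_values_recursion (T : Type) (f : seq T -> T) :
  exists u : nat -> T, forall n, u n = f (mkseq u n).
Proof.
pose s := fix s n := if n is m.+1 then rcons (s m) (f (s m)) else [::].
exists (fun n => f (s n)) => n; congr f.
by elim: n => [|n IHn] //=; rewrite mkseqS -IHn.
Qed.

(** As [n] is nonzero in [k], the polynomial ['X^n - 1] is separable and splits into distinct linear
    factors; among [n] distinct [n]-th roots of unity one is primitive. *)
Lemma prim_root_exists (k : closedFieldType) (n : nat) :
  (0 < n)%N -> (n%:R : k) != 0 -> exists e : k, n.-primitive_root e.
Proof.
move=> n_gt0 n_neq0.
have [r Dp] := closed_field_poly_normal ('X^n - 1 : {poly k}).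
move: Dp; rewrite lead_coefXnsubC // scale1r => Dp.
have sz_r : (n < (size r).+1)%N.
  by rewrite -(size_prod_XsubC r id) -Dp size_XnsubC.
have r_unity : all n.-unity_root r.
  by apply/allP=> z zr; rewrite /root_of_unity Dp root_prod_XsubC.
have uniq_r : uniq r by rewrite -separable_prod_XsubC -Dp separable_Xn_sub_1.
by have /hasP[e _ prim_e] := has_prim_root n_gt0 r_unity uniq_r sz_r; exists e.
Qed.

(** * Composition of series through polynomial truncations *)

Section PowerSeries.

Variable k : closedFieldType.
Implicit Types (A B X F : fps k) (p q : {poly k}).

(* Identities between series are checked modulo z^N, where they reduce to
   identities between polynomials. *)
Definition agree (N : nat) A p := forall i, (i < N)%N -> A i = p`_i.

Definition trunc (N : nat) A : {poly k} := \poly_(i < N) A i.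

Lemma agree_trunc N A : agree N A (trunc N A).
Proof. by move=> i lt_iN; rewrite coef_poly lt_iN. Qed.

Lemma agree_one N : agree N (@fps_one k) 1.
Proof. by move=> i _; rewrite coef1. Qed.

Lemma agree_mul N A B p q :
  agree N A p -> agree N B q -> agree N (fps_mul A B) (p * q).
Proof.
move=> Ap Bq i lt_iN; rewrite coefM; apply: eq_bigr => -[j /= le_ji] _.
rewrite Ap ?Bq //; first by apply: leq_ltn_trans lt_iN; apply: leq_subr.
by apply: leq_trans lt_iN.
Qed.

Lemma agree_exp N A p m : agree N A p -> agree N (fps_exp A m) (p ^+ m).
Proof.
move=> Ap; elim: m => [|m IHm]; first exact: agree_one.
by rewrite exprS; apply: agree_mul.
Qed.

Lemma coef_exp_lt p i n : p`_0 = 0 -> (n < i)%N -> (p ^+ i)`_n = 0.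
Proof.
move=> p0 lt_ni; have Ap : agree n.+1 (fun j => p`_j) p by [].
by rewrite -(agree_exp i Ap) // fps_exp_lt.
Qed.

(** Both coefficients sum the same terms, over [i <= n] for series and over [i < size p] for
    polynomials. The terms vanish beyond either bound, so both sums extend to the common range
    [M]. *)
Lemma agree_comp N X A p q : A 0%N = 0 -> q`_0 = 0 ->
  agree N X p -> agree N A q -> agree N (fps_comp X A) (p \Po q).
Proof.
move=> A0 q0 Xp Aq n lt_nN; rewrite coef_comp_poly /fps_comp.
transitivity (\sum_(i < n.+1) p`_i * (q ^+ i)`_n).
  apply: eq_bigr => -[i /= le_in] _.
  by rewrite Xp ?(agree_exp i Aq) //; apply: leq_trans lt_nN.
pose f i := p`_i * (q ^+ i)`_n.
have f_size i : (size p <= i)%N -> f i = 0.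
  by move=> le_pi; rewrite /f nth_default ?mul0r.
have f_lt i : (n.+1 <= i)%N -> f i = 0.
  by move=> lt_ni; rewrite /f coef_exp_lt ?mulr0.
rewrite -(big_mkord xpredT f) -[RHS](big_mkord xpredT f).
pose M := maxn (size p) n.+1.
have ext m : (m <= M)%N -> (forall i, (m <= i)%N -> f i = 0) ->
    \sum_(0 <= i < m) f i = \sum_(0 <= i < M) f i.
  move=> le_mM f0; rewrite [RHS](big_cat_nat (leq0n m) le_mM) /=.
  by rewrite [X in _ + X]big_nat_cond [X in _ + X]big1 ?addr0 // => i /andP[/andP[/f0]].
by rewrite !ext ?leq_maxl ?leq_maxr.
Qed.

Lemma agree_comp_trunc N X A : A 0%N = 0 ->
  agree N (fps_comp X A) (trunc N X \Po trunc N A).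
Proof.
move=> A0; apply: agree_comp => //; try exact: agree_trunc.
by rewrite coef_poly A0; case: ifP.
Qed.

Lemma agree_inj A B : (forall N, exists2 p, agree N A p & agree N B p) -> A = B.
Proof.
by move=> AB; apply: funext => n; have [p -> // <-] := AB n.+1.
Qed.

Lemma fps_comp0 X A : fps_comp X A 0%N = X 0%N.
Proof. by rewrite /fps_comp big_ord1 /= /fps_one mulr1. Qed.

(** Modulo each [z^N] this is associativity of polynomial composition. *)
Lemma fps_compA X A B : A 0%N = 0 -> B 0%N = 0 ->
  fps_comp (fps_comp X A) B = fps_comp X (fps_comp A B).
Proof.
move=> A0 B0; apply: agree_inj => N.
have tr0 C : C 0%N = 0 -> (trunc N C)`_0 = 0.
  by move=> C0; rewrite coef_poly C0; case: ifP.
exists ((trunc N X \Po trunc N A) \Po trunc N B).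
  by apply: agree_comp; rewrite ?tr0 //; [apply: agree_comp_trunc | apply: agree_trunc].
rewrite -comp_polyA; apply: agree_comp.
- by rewrite fps_comp0.
- by rewrite -horner_coef0 horner_comp !horner_coef0 tr0 // horner_coef0 tr0.
- exact: agree_trunc.
- exact: agree_comp_trunc.
Qed.

(** * Monomials and the identity series *)

Definition monomial (c : k) (n : nat) : fps k := fun i => c * (i == n)%:R.

Lemma agree_monomial N c n : agree N (monomial c n) (c *: 'X^n).
Proof. by move=> i _; rewrite coefZ coefXn. Qed.

Lemma monomial_comp n A : A 0%N = 0 -> fps_comp (monomial 1 n) A = fps_exp A n.
Proof.
move=> A0; apply: agree_inj => N; exists (trunc N A ^+ n); last first.
  by apply: agree_exp; apply: agree_trunc.
rewrite -(comp_Xn_poly (trunc N A) n) -[X in X \Po _]scale1r.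
apply: agree_comp => //; [|exact: agree_monomial|exact: agree_trunc].
by rewrite coef_poly A0; case: ifP.
Qed.

Lemma fps_comp_scale X (e : k) n :
  fps_comp X (monomial e 1) n = X n * e ^+ n.
Proof.
have exp_e i : fps_exp (monomial e 1) i n = e ^+ i * (n == i)%:R.
  rewrite (agree_exp i (@agree_monomial n.+1 e 1)) //.
  by rewrite exprZn exprAC coefZ expr1 coefXn.
rewrite /fps_comp big_ord_recr /= exp_e eqxx mulr1 big1 ?add0r // => -[i lt_in] _.
by rewrite exp_e /= gtn_eqF ?mulr0.
Qed.

Lemma fps_comp_monomial X n : (0 < n)%N ->
  fps_comp X (monomial 1 n) = fun i => if (n %| i)%N then X (i %/ n)%N else 0.
Proof.
move=> n_gt0; apply: funext => i.
have mon0 : monomial 1 n 0%N = 0 by rewrite /monomial ltn_eqF ?mulr0.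
rewrite (@agree_comp i.+1 X _ (trunc i.+1 X) (1 *: 'X^n)) //.
- rewrite scale1r coef_comp_poly_Xn //; case: ifP => // _.
  by rewrite coef_poly ltnS leq_div.
- by rewrite coefZ coefXn ltn_eqF ?mulr0.
- exact: agree_trunc.
- exact: agree_monomial.
Qed.

Definition idfps : fps k := monomial 1 1.

Lemma fps_compX1 X : fps_comp X idfps = X.
Proof. by apply: funext => n; rewrite fps_comp_scale expr1n mulr1. Qed.

Lemma fps_comp1X A : A 0%N = 0 -> fps_comp idfps A = A.
Proof.
move=> A0; rewrite monomial_comp //; apply: agree_inj => N.
exists (trunc N A ^+ 1); first by apply: agree_exp; apply: agree_trunc.
by rewrite expr1; apply: agree_trunc.
Qed.

(** * Orders, compositional inverses and n-th roots *)

Lemma fps_exp_diag A n : A 0%N = 0 -> fps_exp A n n = A 1%N ^+ n.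
Proof.
move=> A0; elim: n => [|n IHn]; first by rewrite /= /fps_one.
(* In the product of [A] and [A^n] only the term with [A 1] survives: [A 0] is zero, and later terms
   involve coefficients of [A^n] below degree [n]. *)
rewrite /= -/(fps_exp A n) /fps_mul 2!big_ord_recl /= A0 mul0r add0r /bump /=.
rewrite subn1 -/(fps_exp A n) IHn -exprS big1 ?addr0 // => -[i /= lt_in] _.
rewrite -/(fps_exp A n) fps_exp_lt ?mulr0 // /bump /=; lia.
Qed.

(** The lowest coefficient of the composite is [X m * A 1 ^+ m]. *)
Lemma fps_ord_comp X A m :
  fps_ord X m -> fps_ord A 1 -> fps_ord (fps_comp X A) m.
Proof.
move=> [Xm_neq0 X_lt] [A1_neq0 A_lt]; have A0 : A 0%N = 0 by apply: A_lt.
split=> [|i lt_im]; rewrite /fps_comp.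
  rewrite big_ord_recr /= fps_exp_diag // big1 => [|[i lt_im] _ /=].
    by rewrite add0r mulf_neq0 ?expf_neq0.
  by rewrite X_lt ?mul0r.
by rewrite big1 // => -[j /= le_ji] _; rewrite X_lt ?mul0r //; apply: leq_trans lt_im.
Qed.

(** The system for the coefficients of [B] is triangular: in degree [n] the unknown [B n] has the
    nonzero factor [A 1 ^+ n], and the other terms involve earlier unknowns only. *)
Lemma fps_left_inverse A : fps_ord A 1 ->
  exists2 B, fps_ord B 1 & fps_comp B A = idfps.
Proof.
move=> [A1_neq0 A_lt]; have A0 : A 0%N = 0 by apply: A_lt.
pose f (s : seq k) := let n := size s in
  (idfps n - \sum_(i < n) s`_i * fps_exp A i n) / A 1%N ^+ n.
have [B DB] := course_of_values_recursion f.
have BA : fps_comp B A = idfps.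
  apply: funext => n; rewrite /fps_comp big_ord_recr /= fps_exp_diag //.
  rewrite [B n]DB /f size_mkseq divfK ?expf_neq0 //.
  under [X in _ - X]eq_bigr => i _ do rewrite nth_mkseq //.
  by rewrite addrC subrK.
exists B => //.
have B0 : B 0%N = 0 by rewrite -(fps_comp0 B A) BA /idfps /monomial mulr0.
(* If [B 1] were zero, the coefficient of [z] in [fps_comp B A] would be 0 instead of 1. *)
split=> [|[|i] //]; apply: contraTneq (oner_neq0 k) => B1; rewrite negbK.
have := congr1 (fun C : fps k => C 1%N) BA.
rewrite /idfps /monomial mulr1 /fps_comp big_ord_recr big_ord1 /= B0 B1.
by rewrite !mul0r addr0 => ->.
Qed.

(** The usual group argument: if [C] is a left inverse of [B], itself a left inverse of [A], then
    associativity gives [A = C]. *)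
Lemma fps_inverse A : fps_ord A 1 ->
  exists B, [/\ fps_ord B 1, fps_comp B A = idfps & fps_comp A B = idfps].
Proof.
move=> ordA; have [B ordB BA] := fps_left_inverse ordA.
have [C _ CB] := fps_left_inverse ordB; exists B; split=> //.
have A0 : A 0%N = 0 by apply: ordA.2.
have B0 : B 0%N = 0 by apply: ordB.2.
suff -> : A = C by [].
by rewrite -[A]fps_comp1X // -CB fps_compA // BA fps_compX1.
Qed.

(* The increment is linear in c, so an n-th root of a series with nonzero
   constant term can be found one coefficient at a time. *)
Lemma coef_expD_monomial p (c : k) n j : (0 < j)%N ->
  ((p + c *: 'X^j) ^+ n)`_j = (p ^+ n)`_j + c * (n%:R * p`_0 ^+ n.-1).
Proof.
(* Factor [q ^+ n - p ^+ n] by [q - p = c *: 'X^j]: the [j]-th coefficient is then [c] times the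
   constant term of the cofactor, whose [n] summands each contribute [p_0^(n-1)]. *)
move=> j_gt0; set q := p + _; apply/eqP; rewrite addrC -subr_eq -coefB subrXX.
rewrite [q - p]addrC /q addKr -scalerAl coefZ coefXnM ltnn subnn.
rewrite -horner_coef0 horner_sum (eq_bigr (fun=> p`_0 ^+ n.-1)).
  by rewrite sumr_const card_ord mulr_natl eqxx.
move=> [i /= lt_in] _; rewrite !hornerE !horner_coef0 expr0n gtn_eqF // mulr0 addr0.
by rewrite -exprD; congr (_ ^+ _); lia.
Qed.

Lemma truncS N A : trunc N.+1 A = trunc N A + A N *: 'X^N.
Proof. by rewrite /trunc !poly_def big_ord_recr. Qed.

Lemma fps_unit_root (char0 : [pchar k] =i pred0) A n : (0 < n)%N -> A 0%N != 0 ->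
  exists B, fps_exp B n = A.
Proof.
move=> n_gt0 A0_neq0.
(* The monic equation solved here is [r ^+ n = A 0]. *)
have [r Dr] := solve_monicpoly (fun i => if i == 0%N then A 0%N else 0) n_gt0.
have {}Dr : r ^+ n = A 0%N.
  rewrite Dr -(prednK n_gt0) big_ord_recl /= mulr1 big1 ?addr0 // => i _.
  by rewrite mul0r.
(* The slope of the [j]-th coefficient of [B^n] as a function of [B j], for positive [j];
   characteristic zero makes it invertible. *)
pose d : k := n%:R * r ^+ n.-1.
have d_neq0 : d != 0.
  have /pcharf0P n_eq0 := char0.
  rewrite mulf_neq0 ?n_eq0 -?lt0n // expf_neq0 //.
  by apply: contraNneq A0_neq0 => r0; rewrite -Dr r0 expr0n gtn_eqF.
pose f (s : seq k) := let j := size s in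
  if j == 0%N then r else (A j - (Poly s ^+ n)`_j) / d.
have [B DB] := course_of_values_recursion f.
have B0 : B 0%N = r by rewrite DB.
exists B; apply: funext => j.
rewrite (agree_exp n (@agree_trunc j.+1 B)) // truncS.
case: j => [|j].
  by rewrite /trunc poly_def big_ord0 add0r -horner_coef0 !hornerE B0 Dr.
rewrite coef_expD_monomial // coef_poly /= B0 -/d [B j.+1]DB /f size_mkseq /=.
have -> : trunc j.+1 B = Poly (mkseq B j.+1) by rewrite /trunc unlock.
by rewrite divfK // addrC subrK.
Qed.

(** Write [A = z^n U] with [U] of nonzero constant term; if [C^n = U], then [B = z C] is a root of
    order 1. *)
Lemma fps_root (char0 : [pchar k] =i pred0) A n :
  (0 < n)%N -> fps_ord A n -> exists2 B, fps_ord B 1 & fps_exp B n = A.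
Proof.
move=> n_gt0 [An_neq0 A_lt].
have [|C DC] := @fps_unit_root char0 (fun i => A (n + i)%N) n n_gt0.
  by rewrite addn0.
pose B : fps k := fun i => if i is j.+1 then C j else 0.
exists B.
  split=> [|[|i] //]; apply: contraNneq An_neq0 => B1; have C0 : C 0%N = 0 by [].
  rewrite -[n in A n]addn0 -[A _]/((fun i => A (n + i)%N) 0%N) -DC.
  have -> : fps_exp C n 0%N = C 0%N ^+ n.
    by rewrite (agree_exp n (@agree_trunc 1 C)) // -horner_coef0 horner_exp horner_coef0 coef_poly.
  by rewrite C0 expr0n gtn_eqF.
apply: funext => i.
have B_agree : agree i.+1 B ('X * trunc i.+1 C).
  by move=> [|j] lt_ji; rewrite coefXM //= coef_poly ltnW.
rewrite (agree_exp n B_agree) // exprMn coefXnM; case: ltnP => [/A_lt -> //|le_ni].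
by rewrite -(agree_exp n (@agree_trunc i.+1 C)) ?DC ?subnKC // ltnS leq_subr.
Qed.

End PowerSeries.

(** * Transition groups and right factors *)

Section Main.

Variables (k : closedFieldType) (char0 : [pchar k] =i pred0).
Implicit Types (A B X F : fps k).

Lemma fps_ord0 A n : (0 < n)%N -> fps_ord A n -> A 0%N = 0.
Proof. by move=> n_gt0 [_]; apply. Qed.

Lemma transition_group_comp X A : A 0%N = 0 ->
  transition_group A `<=` transition_group (fps_comp X A).
Proof.
move=> A0 phi [ord_phi Aphi]; split=> //.
by rewrite fps_compA ?Aphi //; apply: (fps_ord0 _ ord_phi).
Qed.

Lemma transition_group_factor A F n m : (0 < n)%N ->
  fps_ord A n -> fps_ord F (n * m) ->
  transition_group A `<=` transition_group F ->
  exists2 X, fps_ord X m & F = fps_comp X A.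
Proof.
move=> n_gt0 ordA ordF sub_AF.
have [a ord_a DA] := fps_root char0 n_gt0 ordA.
have [b [ord_b ba ab]] := fps_inverse ord_a.
have a0 := fps_ord0 (ltn0Sn 0) ord_a; have b0 := fps_ord0 (ltn0Sn 0) ord_b.
have mon0 e i : (0 < i)%N -> monomial e i 0%N = 0 :> k.
  by move=> i_gt0; rewrite /monomial ltn_eqF ?mulr0.
have {}DA : A = fps_comp (monomial 1 n) a by rewrite monomial_comp.
have n_neq0 : n%:R != 0 :> k by have /pcharf0P -> := char0; rewrite -lt0n.
have [e prim_e] := prim_root_exists n_gt0 n_neq0.
have e_neq0 : e != 0 by rewrite (prim_root_eq0 prim_e) -lt0n.
pose ea := fps_comp (monomial e 1) a.
have ea0 : ea 0%N = 0 by rewrite /ea fps_comp0 mon0.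
have ord_e : fps_ord (monomial e 1) 1.
  by split=> [|[|i] //]; rewrite ?mon0 // /monomial mulr1.
have ord_ea : fps_ord ea 1 by apply: fps_ord_comp.
have b_ea0 : fps_comp b ea 0%N = 0 by rewrite fps_comp0.
have a_b_ea : fps_comp a (fps_comp b ea) = ea.
  by rewrite -fps_compA // ab fps_comp1X.
have [_ DF] : transition_group F (fps_comp b ea).
  apply: sub_AF; split; first exact: fps_ord_comp.
  (* The conjugate [fps_comp b ea] fixes [A] because [(e z)^n = z^n]. *)
  rewrite {1}DA fps_compA // a_b_ea /ea -fps_compA ?mon0 //.
  rewrite [X in fps_comp X a](_ : _ = monomial 1 n) -?DA //.
  apply: funext => i; rewrite fps_comp_scale /monomial.
  by case: eqP => [->|_]; rewrite ?mulr0 ?mul0r // (prim_expr_order prim_e) !mulr1.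
pose Y := fps_comp F b.
have DY : F = fps_comp Y a by rewrite /Y fps_compA // ba fps_compX1.
(* This is invariance of [Y] under [e z]: since [e z = ea o b], one has
   [Y o (e z) = F o (b o ea) o b = F o b = Y]. *)
have Y_scale i : Y i * e ^+ i = Y i.
  rewrite -fps_comp_scale; congr (_ i).
  have De : monomial e 1 = fps_comp ea b.
    by rewrite /ea fps_compA // ab fps_compX1.
  by rewrite De -fps_compA // /Y (fps_compA F) // DF.
have ordY : fps_ord Y (n * m) by apply: fps_ord_comp.
exists (fun i => Y (n * i)%N).
  by split=> [|i lt_im]; [apply: ordY.1 | apply: ordY.2; rewrite ltn_pmul2l].
rewrite DA -fps_compA ?mon0 // fps_comp_monomial // {1}DY.
congr fps_comp; apply: funext => i; case: ifP => [/divnK <-|ndvd_ni].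
  by rewrite mulnK // mulnC.
(* Here [Y i * (e ^+ i - 1) = 0], and [e ^+ i] differs from 1 when [n] does not divide [i]. *)
apply/eqP; have /eqP := Y_scale i; rewrite -subr_eq0 -[X in _ - X]mulr1 -mulrBr.
by rewrite mulf_eq0 subr_eq0 -(prim_order_dvd prim_e) ndvd_ni orbF.
Qed.

End Main.

Theorem theorem1p2 (k : closedFieldType) (char0 : [pchar k] =i pred0) :
  (forall (n m : nat) (A F : fps k),
      (2 <= n)%N -> (1 <= m)%N -> fps_of_ord n A -> fps_of_ord (n * m) F ->
      ((exists X : fps k, fps_of_ord m X /\ F = fps_comp X A) <->
       transition_group A `<=` transition_group F))
  /\
  (forall A B : fps k,
      Gamma A -> Gamma B -> (exists n : nat, fps_ord A n /\ fps_ord B n) ->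
      (transition_group A = transition_group B <->
       exists mu : fps k, fps_of_ord 1 mu /\ B = fps_comp mu A)).
Proof.
split=> [n m A F n_ge2 _ ordA ordF|A B [n n_ge2 ordA] _ [n' [ordA' ordB]]].
  have n_gt0 := ltnW n_ge2.
  split=> [[X [_ ->]]|sub_AF].
    exact/transition_group_comp/(fps_ord0 n_gt0 ordA).
  by have [X] := transition_group_factor char0 n_gt0 ordA ordF sub_AF; exists X.
have A0 := fps_ord0 (ltnW n_ge2) ordA.
(* The common order [n'] comes from a separate existential than the order [n] in [Gamma A]; it is
   positive because [A 0] vanishes. *)
have n'_gt0 : (0 < n')%N.
  by rewrite lt0n; apply: contraTneq ordA'.1 => ->; rewrite A0 eqxx.
split=> [eqAB|[mu [ord_mu DB]]].
  have sub_AB : transition_group A `<=` transition_group B by rewrite eqAB.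
  (* Equal orders mean [m = 1], so the left factor is invertible. *)
  have [|mu] := transition_group_factor (m := 1) char0 n'_gt0 ordA' _ sub_AB.
    by rewrite muln1.
  by exists mu.
(* Inverting [mu] makes each of [A] and [B] a left composite of the other, which yields both
   inclusions. *)
have [nu [_ nu_mu _]] := fps_inverse ord_mu.
have DA : A = fps_comp nu B.
  by rewrite DB -fps_compA ?nu_mu ?fps_comp1X // (fps_ord0 _ ord_mu).
rewrite eqEsubset; split; first by rewrite DB; apply: transition_group_comp.
by rewrite DA; apply: transition_group_comp; apply: (fps_ord0 n'_gt0 ordB).
Qed.
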